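(* Let $X$ and $Y$ be normed vector spaces over $\mathbb{R}$ with norms $\|\cdot\|_X$ and $\|\cdot\|_Y$, let $\Omega\subseteq X$ be open, and let $f:\Omega\to Y$ be a function. If $f$ is specularly Fréchet differentiable at $x\in\Omega$ with specular Fréchet differential $\widehat{D}f(x)$, then $f$ is specularly Gâteaux differentiable at $x$, and for every direction $v\in X\setminus\{0\}$ one has $\partial_v^{\wedge}f(x)=\widehat{D}f(x)(v)$.
   Context: $\mathcal{L}(X;Y)$ is the space of continuous linear operators $X\to Y$. The product norm is $\|(x,y)\|_{X\times Y}:=(\|x\|_X^2+\|y\|_Y^2)^{1/2}$. Specular directional derivative: for $v\in X\setminus\{0\}$, $$\partial_v^{\wedge}f(x):=\lim_{h\searrow 0}\left[\frac{f(x+hv)-f(x)}{h}\cdot\frac{\|U\|_{X\times Y}}{\|U\|_{X\times Y}+\|V\|_{X\times Y}}+\frac{f(x)-f(x-hv)}{h}\cdot\frac{\|V\|_{X\times Y}}{\|U\|_{X\times Y}+\|V\|_{X\times Y}}\right]$$ (limit over $h>0$, in $Y$), when it exists, where $U:=(hv,f(x)-f(x-hv))$ and $V:=(hv,f(x+hv)-f(x))$ for sufficiently small $h>0$; and $\partial_0^{\wedge}f(x):=0$. $f$ is specularly Gâteaux differentiable at $x$ if $\partial_v^{\wedge}f(x)$ exists for all $v\in X$ and there is $\ell\in\mathcal{L}(X;Y)$ with $\ell(v)=\partial_v^{\wedge}f(x)$ for all $v\in X$. $f$ is specularly Fréchet differentiable at $x\in\Omega$ if there exists $\ell\in\mathcal{L}(X;Y)$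 such that $$\lim_{\|w\|_X\to 0}\left\|\frac{f(x+w)-f(x)-\ell(w)}{\|w\|_X}\cdot\frac{\|J\|_{X\times Y}}{\|J\|_{X\times Y}+\|K\|_{X\times Y}}+\frac{f(x)-f(x-w)-\ell(w)}{\|w\|_X}\cdot\frac{\|K\|_{X\times Y}}{\|J\|_{X\times Y}+\|K\|_{X\times Y}}\right\|_Y=0$$ (limit over nonzero $w\in X$), where $J:=(w,f(x)-f(x-w))$ and $K:=(w,f(x+w)-f(x))$. Such an $\ell$ is called the specular Fréchet differential of $f$ at $x$ and is denoted $\widehat{D}f(x)$. *)

(* Defs.v *)
From HB Require Import structures.
From mathcomp Require Import all_boot all_order all_algebra.
From mathcomp Require Import all_classical all_reals all_analysis.

Set Implicit Arguments.
Unset Strict Implicit.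
Unset Printing Implicit Defensive.

Import Order.TTheory GRing.Theory Num.Theory.
Import numFieldNormedType.Exports.

Local Open Scope classical_set_scope.
Local Open Scope ring_scope.

(* A function on an open set Omega is represented by a total function X -> Y;
   the notions below are local: at a point of Omega they depend only on the
   values of the function near that point, hence not on the values outside. *)

(* The Euclidean product norm, as opposed to the max norm that the library puts
   on X * Y. *)
Definition prod_norm2 (R : realType) (X Y : normedModType R) (p : X * Y) : R :=
  Num.sqrt (`|p.1| ^+ 2 + `|p.2| ^+ 2).

Definition backward_chord (R : realType) (X Y : normedModType R)
    (f : X -> Y) (x w : X) : X * Y :=
  (w, f x - f (x - w)).

Definition forward_chord (R : realType) (X Y : normedModType R)
    (f : X -> Y) (x w : X) : X * Y :=
  (w, f (x + w) - f x).

Definition specular_quotient (R : realType) (X Y : normedModType R)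
    (f : X -> Y) (x v : X) (h : R) : Y :=
  let U := prod_norm2 (backward_chord f x (h *: v)) in
  let V := prod_norm2 (forward_chord f x (h *: v)) in
  (U / (U + V)) *: (h^-1 *: (f (x + h *: v) - f x)) +
  (V / (U + V)) *: (h^-1 *: (f x - f (x - h *: v))).

Definition specular_derivable (R : realType) (X Y : normedModType R)
    (f : X -> Y) (x v : X) : Prop :=
  v != 0 -> cvg (specular_quotient f x v h @[h --> 0^'+]).

(* Meaningful only under [specular_derivable f x v]. *)
Definition specular_derive (R : realType) (X Y : normedModType R)
    (f : X -> Y) (x v : X) : Y :=
  if v == 0 then 0 else lim (specular_quotient f x v h @[h --> 0^'+]).

Definition specular_gateaux_differentiable (R : realType)
    (X Y : normedModType R) (f : X -> Y) (x : X) : Prop :=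
  (forall v : X, specular_derivable f x v) /\
  exists l : {linear X -> Y},
    continuous l /\ forall v : X, l v = specular_derive f x v.

Definition specular_frechet_remainder (R : realType) (X Y : normedModType R)
    (f : X -> Y) (x : X) (l : X -> Y) (w : X) : Y :=
  let J := prod_norm2 (backward_chord f x w) in
  let K := prod_norm2 (forward_chord f x w) in
  (J / (J + K)) *: (`|w|^-1 *: (f (x + w) - f x - l w)) +
  (K / (J + K)) *: (`|w|^-1 *: (f x - f (x - w) - l w)).

(* [l] is a specular Frechet differential of [f] at [x]; [f] is specularly
   Frechet differentiable at [x] when such an [l] exists. *)
Definition is_specular_frechet_differential (R : realType)
    (X Y : normedModType R) (f : X -> Y) (x : X) (l : {linear X -> Y}) : Prop :=
  continuous l /\
  `|specular_frechet_remainder f x l w| @[w --> (0 : X)^'] --> (0 : R).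

(* Main.v *)
Require Import Defs.
From HB Require Import structures.
From mathcomp Require Import all_boot all_order all_algebra.
From mathcomp Require Import all_classical all_reals all_analysis.

Import Order.TTheory GRing.Theory Num.Theory.
Import numFieldNormedType.Exports.

Local Open Scope classical_set_scope.
Local Open Scope ring_scope.

(** The Fréchet remainder sees a direction [v] along the ray [w = h *: v],
    [h > 0]. On that ray the chords [J], [K] of the Fréchet definition are
    literally the chords [U], [V] of the directional one, so both expressions
    carry the same weights. These weights add up to 1, hence subtracting the
    linear term inside each difference quotient amounts to subtracting [l v]
    from the weighted mean; only the normalisation by [`|h *: v|] instead of
    [h] remains, which costs the constant factor [`|v|]. This is the exact
    identity [specular_quotient_sub_linear]. Since [h *: v] tends to 0 through
    nonzero vectors, the quotient tends to [l v]
    ([specular_quotient_cvg_differential]), and uniqueness of limits identifies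
    the specular directional derivative; the differential itself is then the
    continuous linear map required for Gâteaux differentiability. *)

Lemma prod_norm2_gt0 {R : realType} {X Y : normedModType R} {w : X} (y : Y) :
  w != 0 -> 0 < prod_norm2 (w, y).
Proof.
by move=> w0; rewrite sqrtr_gt0 ltr_wpDr ?sqr_ge0// exprn_gt0// normr_gt0.
Qed.

(** As the weights add up to 1, [y] is its own weighted mean: this is why the
    linear term can be moved out of the two difference quotients. *)
Lemma affine_comb_subZ {R : comPzRingType} {Y : lmodType R} {a b : R} (c : R)
    (p q y : Y) : a + b = 1 ->
  a *: (c *: (p - y)) + b *: (c *: (q - y)) = c *: (a *: p + b *: q - y).
Proof.
move=> ab1.
have scaleCA (r : R) (z : Y) : r *: (c *: z) = c *: (r *: z).
  by rewrite !scalerA mulrC.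
rewrite !scaleCA -scalerDr; congr (c *: _).
by rewrite !scalerBr addrACA -opprD -scalerDl ab1 scale1r.
Qed.

(** Holds exactly, not just in the limit: by linearity
    [l (h *: v) / `|h *: v|] is [l v / `|v|], so both difference quotients
    have the same term to subtract, and positivity of [h] makes
    [`|h *: v|] equal to [h * `|v|]. *)
Lemma specular_quotient_sub_linear {R : realType} {X Y : normedModType R}
    {f : X -> Y} {x v : X} {l : {linear X -> Y}} {h : R} :
  v != 0 -> 0 < h ->
  specular_quotient f x v h - l v =
  `|v| *: specular_frechet_remainder f x l (h *: v).
Proof.
move=> v0 h0; have w0 : h *: v != 0 by rewrite scaler_eq0 negb_or gt_eqF.
have nv0 : `|v| != 0 by rewrite normr_eq0.
rewrite /specular_quotient /specular_frechet_remainder.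
set U := prod_norm2 (backward_chord _ _ _).
set V := prod_norm2 (forward_chord _ _ _).
have UV0 : U + V != 0 by rewrite gt_eqF// addr_gt0// prod_norm2_gt0.
have weights1 : U / (U + V) + V / (U + V) = 1 by rewrite -mulrDl divff.
have normalise (z : Y) :
    `|h *: v|^-1 *: (z - l (h *: v)) = `|v|^-1 *: (h^-1 *: z - l v).
  have -> : l (h *: v) = h *: l v by exact: linearZ.
  rewrite normrZ gtr0_norm// invfM mulrC -scalerA; congr (_ *: _).
  by rewrite scalerBr (scalerA _ h) mulVf ?gt_eqF// scale1r.
rewrite !normalise affine_comb_subZ//.
by rewrite [RHS]scalerA divff// scale1r.
Qed.

(** The punctured neighbourhoods matter: the remainder is only controlled at
    nonzero vectors, and [h *: v] is nonzero because both [h] and [v] are. *)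
Lemma scaler_cvg_dnbhs0 {R : realType} {X : normedModType R} {v : X} :
  v != 0 -> h *: v @[h --> (0 : R)^'+] --> (0 : X)^'.
Proof.
move=> v0 A; rewrite /dnbhs /within /= => A0.
have : h *: v @[h --> (0 : R)^'+] --> (0 : X).
  apply: cvg_at_right_filter; rewrite -[X in _ --> X](scale0r v).
  exact: scalel_continuous.
move=> /(_ _ A0) hA.
have {}hA : \forall h \near (0 : R)^'+, h *: v != 0 -> A (h *: v) by exact: hA.
rewrite nbhs_simpl /=; near=> h.
have hv0 : h *: v != 0 by rewrite scaler_eq0 negb_or gt_eqF.
by apply: (near hA h).
Unshelve. all: by end_near. Qed.

Lemma specular_quotient_cvg_differential (R : realType)
    (X Y : normedModType R) (f : X -> Y) (x v : X) (l : {linear X -> Y}) :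
  is_specular_frechet_differential f x l -> v != 0 ->
  specular_quotient f x v h @[h --> 0^'+] --> l v.
Proof.
move=> [_ rem0] v0; apply/subr_cvg0/norm_cvg0P.
have : `|v| * `|specular_frechet_remainder f x l (h *: v)|
    @[h --> (0 : R)^'+] --> `|v| * 0.
  by apply: cvgMr; exact: cvg_comp (scaler_cvg_dnbhs0 v0) rem0.
rewrite mulr0; apply: cvg_trans; apply: near_eq_cvg; near=> h.
by rewrite specular_quotient_sub_linear// normrZ normr_id.
Unshelve. all: by end_near. Qed.

Theorem proposition5p3 (R : realType) (X Y : normedModType R) (Omega : set X)
    (f : X -> Y) (x : X) (Df : {linear X -> Y}) :
  open Omega -> Omega x ->
  is_specular_frechet_differential f x Df ->
  specular_gateaux_differentiable f x /\
  forall v : X, v != 0 -> specular_derive f x v = Df v.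
Proof.
move=> _ _ fDf.
have deriveE (v : X) : v != 0 -> specular_derive f x v = Df v.
  move=> v0; rewrite /specular_derive (negbTE v0).
  apply: cvg_lim; first exact: norm_hausdorff.
  exact: specular_quotient_cvg_differential.
split=> //; split=> [v v0|].
  by apply/cvg_ex; exists (Df v); exact: specular_quotient_cvg_differential.
exists Df; split=> [|v]; first exact: fDf.1.
have [->|/deriveE//] := eqVneq v 0.
by rewrite linear0 /specular_derive eqxx.
Qed.
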